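(* Let $\mathbb{F}$ be a field with $\mathrm{char}(\mathbb{F})\neq 2,3$. The map $$(\beta_3,\beta_6,\dots,\beta_{3k})\mapsto\Big(\sum_{j=1}^k\beta_{3j}\,p_{\bar1,3j}\Big)$$ (ideal generated by the indicated element) induces a bijection between the set of tuples $(\beta_3,\dots,\beta_{3k})\in\mathbb{F}^k$ with $k\in\mathbb{N}$ and $\beta_{3k}\neq0$, taken up to non-zero scalar multiples, and the set of non-zero ideals $I$ of $\hat{\mathcal{H}}$ with $I\subseteq J$. The inverse map sends $I$ to the tuple of coefficients of an element of minimal $J$-degree in $I$. In particular, every ideal contained in $J$ is principal.
   Context: Notation: $\mathbb{N}=\{1,2,3,\dots\}$, $3\mathbb{N}=\{3,6,9,\dots\}$; for $r\in\mathbb{Z}$, $\bar r=r+3\mathbb{Z}\in\mathbb{Z}_3$. The algebra $\hat{\mathcal{H}}$ is the commutative $\mathbb{F}$-algebra with basis $\{a_i:i\in\mathbb{Z}\}\cup\{s_j:j\in\mathbb{N}\}\cup\{p_{\bar r,k}:\bar r\in\{\bar1,\bar2\},\ k\in 3\mathbb{N}\}$, where $s_0=0$, $p_{\bar r,j}=0$ for all $\bar r$ whenever $j\notin 3\mathbb{N}$, $p_{\bar 0,j}=-p_{\bar1,j}-p_{\bar2,j}$, $z_{\bar r,j}=p_{\bar r+\bar1,j}-p_{\bar r-\bar1,j}$, and for $i,i'\in\mathbb{Z}$, $j,l\in\mathbb{N}$, $h,k\in3\mathbb{N}$, $\bar r,\bar t\in\mathbb{Z}_3$: (H1) $a_ia_{i'}=\tfrac12(a_i+a_{i'})+s_{|i-i'|}+z_{\bar\imath,|i-i'|}$;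 (H2) $a_is_j=-\tfrac34a_i+\tfrac38(a_{i-j}+a_{i+j})+\tfrac32 s_j-z_{\bar\imath,j}$; (H3) $a_ip_{\bar r,k}=\tfrac32p_{\bar r,k}-p_{-(\bar\imath+\bar r),k}$; (H4) $s_js_l=\tfrac34(s_j+s_l)-\tfrac38(s_{|j-l|}+s_{j+l})$; (H5) $s_jp_{\bar r,k}=\tfrac34(p_{\bar r,j}+p_{\bar r,k})-\tfrac38(p_{\bar r,|j-k|}+p_{\bar r,j+k})$; (H6) $p_{\bar r,h}p_{\bar t,k}=\tfrac14(z_{-(\bar r+\bar t),h}+z_{-(\bar r+\bar t),k})-\tfrac18(z_{-(\bar r+\bar t),|h-k|}+z_{-(\bar r+\bar t),h+k})$. $J=\langle p_{\bar1,j},p_{\bar2,j}:j\in3\mathbb{N}\rangle$ (an ideal). Every non-zero $x\in J$ is uniquely $x=\sum_{j\in3\mathbb{N},\,j\le 3m}\sum_{\bar r\in\{\bar1,\bar2\}}\beta_{\bar r,j}p_{\bar r,j}$ with $\beta_{\bar r,3m}\neq0$ for some $\bar r$; its $p$-level is $3m$ and its $J$-degree is $3m+\sum_{r\in\{1,2\},\ \beta_{\bar r,3m}\neq0}\tfrac r4$. *)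

(* Defs.v *)
From HB Require Import structures.
From mathcomp Require Import all_boot all_order all_algebra.
Set Implicit Arguments. Unset Strict Implicit. Unset Printing Implicit Defensive.
Import Order.TTheory GRing.Theory Num.Theory.
Local Open Scope ring_scope.

(* The algebra \hat H is described by its presentation: an F-vector space V
   with a commutative bilinear (not necessarily associative) product [mul],
   and a family a_i (i : int), s_j (j >= 1), p_{r,k} (r in {1,2}, k in 3N)
   which is a basis of V and satisfies (H1)-(H6).  Conventions: s_0 = 0,
   p_{r,j} = 0 for j not in 3N, p_{0,j} = -p_{1,j} - p_{2,j}. *)

Section Hhat.
Variables (F : fieldType) (V : lmodType F).
Variable mul : V -> V -> V.
Variables (a : int -> V) (s : nat -> V) (p : 'Z_3 -> nat -> V).

Definition zbar (i : int) : 'Z_3 := i%:~R.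

Definition z (r : 'Z_3) (j : nat) : V := p (r + 1) j - p (r - 1) j.

Definition in3N (j : nat) : bool := (0 < j)%N && (3 %| j)%N.

Definition hidx := (int + (nat + (bool * nat)))%type.

Definition hbasis (b : hidx) : V :=
  match b with
  | inl i => a i
  | inr (inl j) => s j.+1
  | inr (inr (t, m)) => p (if t then 2%R else 1%R) (3 * m.+1)
  end.

Record is_Hhat : Prop := {
  Hh_mulC : forall x y, mul x y = mul y x;
  Hh_mulDl : forall (c : F) x y w, mul (c *: x + y) w = c *: mul x w + mul y w;
  Hh_free : forall (l : seq hidx) (c : hidx -> F), uniq l ->
      \sum_(b <- l) c b *: hbasis b = 0 -> forall b, b \in l -> c b = 0;
  Hh_span : forall v, exists (l : seq hidx) (c : hidx -> F),
      v = \sum_(b <- l) c b *: hbasis b;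
  Hh_s0 : s 0 = 0;
  Hh_pout : forall r j, ~~ in3N j -> p r j = 0;
  Hh_p0 : forall j, p 0 j = - p 1 j - p 2 j;
  Hh_H1 : forall i i' : int,
      mul (a i) (a i') = 2^-1 *: (a i + a i') + s `|i - i'|%N + z (zbar i) `|i - i'|%N;
  Hh_H2 : forall (i : int) (j : nat), (0 < j)%N ->
      mul (a i) (s j) = - (3 / 4) *: a i + (3 / 8) *: (a (i - j%:Z) + a (i + j%:Z))
                        + (3 / 2) *: s j - z (zbar i) j;
  Hh_H3 : forall (i : int) (r : 'Z_3) (k : nat), in3N k ->
      mul (a i) (p r k) = (3 / 2) *: p r k - p (- (zbar i + r)) k;
  Hh_H4 : forall j l : nat, (0 < j)%N -> (0 < l)%N ->
      mul (s j) (s l) = (3 / 4) *: (s j + s l) - (3 / 8) *: (s `|j - l|%N + s (j + l));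
  Hh_H5 : forall (j : nat) (r : 'Z_3) (k : nat), (0 < j)%N -> in3N k ->
      mul (s j) (p r k) = (3 / 4) *: (p r j + p r k)
                          - (3 / 8) *: (p r `|j - k|%N + p r (j + k));
  Hh_H6 : forall (r t : 'Z_3) (h k : nat), in3N h -> in3N k ->
      mul (p r h) (p t k) = 4^-1 *: (z (- (r + t)) h + z (- (r + t)) k)
                            - 8^-1 *: (z (- (r + t)) `|h - k|%N + z (- (r + t)) (h + k))
}.

Definition is_ideal (I : V -> Prop) : Prop :=
  I 0 /\ (forall (c : F) x y, I x -> I y -> I (c *: x + y)) /\
  (forall x y, I x -> I (mul y x)).

Definition ideal_gen (S : V -> Prop) (x : V) : Prop :=
  forall I, is_ideal I -> (forall y, S y -> I y) -> I x.

Definition pideal (x : V) : V -> Prop := ideal_gen (fun y => y = x).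

Definition same_set (I I' : V -> Prop) : Prop := forall x, I x <-> I' x.

Definition subset_of (I I' : V -> Prop) : Prop := forall x, I x -> I' x.

Definition Jideal : V -> Prop :=
  ideal_gen (fun y => exists (r : 'Z_3) (k : nat),
                 in3N k /\ (r = 1 \/ r = 2%R) /\ y = p r k).

(* tuple (beta_3, ..., beta_{3k}) stored as the sequence [beta_3; ...; beta_{3k}] *)
Definition valid_tuple (beta : seq F) : bool :=
  (0 < size beta)%N && (last 0 beta != 0).

Definition pelt (beta : seq F) : V :=
  \sum_(j < size beta) beta`_j *: p 1 (3 * j.+1).

Definition Jdeg (x : V) (d : rat) : Prop :=
  exists (m : nat) (c1 c2 : nat -> F),
    x = \sum_(j < m.+1) (c1 j *: p 1 (3 * j.+1) + c2 j *: p 2 (3 * j.+1)) /\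
    (c1 m != 0 \/ c2 m != 0) /\
    d = (3 * m.+1)%:R + (nat_of_bool (c1 m != 0))%:R / 4
        + (nat_of_bool (c2 m != 0))%:R * 2 / 4.

Definition min_Jdeg (I : V -> Prop) (x : V) : Prop :=
  I x /\ x != 0 /\
  exists d, Jdeg x d /\ forall y e, I y -> y != 0 -> Jdeg y e -> (d <= e)%R.

End Hhat.

(* Main.v *)
Require Import Defs.
From HB Require Import structures.
From mathcomp Require Import all_boot all_order all_algebra.
From mathcomp Require Import ring lra zify.
From Stdlib Require Import Classical.
Import Order.TTheory GRing.Theory Num.Theory.
Local Open Scope ring_scope.
Set Implicit Arguments. Unset Strict Implicit. Unset Printing Implicit Defensive.

(** The reflections [3/2 - a_i] generate an action of S_3 on the span of the p_r,
    which is an irreducible plane W because 3 is invertible; hence J = W (x) X with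
    X the span of the indices k, and an ideal inside J is W (x) Y for a subspace Y
    of X.  The elements s_3m and p_{r,3m} act on the factor X through the rule
    q_m q_k = 2 q_m + 2 q_k - q_{|m-k|} - q_{m+k}, which is satisfied by
    q_k = 2 - t^k - t^-k, a polynomial of degree k in q_1 vanishing at q_1 = 0.
    So X is the free module of rank one over F[q_1], Y is generated by a single
    polynomial f, and comparing degrees with that of f identifies the elements of
    minimal J-degree with the non-zero scalar multiples of p_1 (x) f. *)

(** * Chebyshev-type polynomials and coordinates of F[X] in them *)

Section Cheb.
Variable F : fieldType.

(* With X = 2 - t - t^-1, [cheb k] is (2 - t^k - t^-k) / X: this explains both
   the recursion and the product rule [cheb_mul]. *)
Fixpoint cheb2 (k : nat) : {poly F} * {poly F} :=
  if k is k'.+1 then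
    let: (u, v) := cheb2 k' in (v, 2 * v + 2 - u - 'X * v)
  else (0, 1).

Definition cheb k := (cheb2 k).1.

Lemma cheb0 : cheb 0 = 0. Proof. by []. Qed.
Lemma cheb1 : cheb 1 = 1. Proof. by []. Qed.

Lemma chebSS k : cheb k.+2 = 2 * cheb k.+1 + 2 - cheb k - 'X * cheb k.+1.
Proof. by rewrite /cheb /=; case: (cheb2 k) => u v. Qed.

(** In the recursion the term [- 'X * cheb k.+1] strictly dominates in degree, with leading
    coefficient a sign, so this holds in every characteristic. *)
Lemma size_cheb k : size (cheb k) = k.
Proof.
suff [] : size (cheb k) = k /\ size (cheb k.+1) = k.+1 by [].
elim: k => [|k [IH1 IH2]]; first by rewrite cheb0 cheb1 size_poly0 size_poly1.
split=> //.
have sX : size (- ('X * cheb k.+1)) = k.+2.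
  by rewrite size_polyN mulrC size_mulX -?size_poly_gt0 IH2.
rewrite chebSS addrC size_polyDl sX // ltnS.
apply: (leq_trans (size_polyD _ _)); rewrite size_polyN IH1 geq_max leqnSn andbT.
apply: (leq_trans (size_polyD _ _)); rewrite geq_max; apply/andP; split.
  by rewrite mulr_natl -scaler_nat (leq_trans (size_scale_leq _ _)) ?IH2.
by rewrite -polyC_natr (leq_trans (size_polyC_leq1 _)).
Qed.

Lemma cheb_mul_leq m d :
  'X * cheb m * cheb (m + d) =
  2 * (cheb m + cheb (m + d)) - (cheb d + cheb (m + (m + d))).
Proof.
pose P m := forall d, 'X * cheb m * cheb (m + d) =
  2 * (cheb m + cheb (m + d)) - (cheb d + cheb (m + (m + d))).
suff [] : P m /\ P m.+1 by [].
elim: m {d} => [|m [IH1 IH2]].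
  split=> d; first by rewrite cheb0 !add0n; ring.
  by rewrite cheb1 !add1n chebSS; ring.
split=> // d.
(* The shifts [d.+2] and [d.+1] give both hypotheses the same second factor, of index [m + d + 2],
   so the recursion for the first factor combines them. *)
have := IH1 d.+2; have := IH2 d.+1.
rewrite (_ : m.+2 + d = m + d.+2)%N; last by lia.
rewrite (_ : m.+1 + d.+1 = m + d.+2)%N; last by lia.
rewrite (_ : m.+1 + (m + d.+2) = (m + (m + d)).+3)%N; last by lia.
rewrite (_ : m + (m + d.+2) = (m + (m + d)).+2)%N; last by lia.
rewrite (_ : m.+2 + (m + d.+2) = (m + (m + d)).+4)%N; last by lia.
rewrite (chebSS m) (chebSS (m + (m + d)).+2) (chebSS d).
set A := cheb m; set B := cheb m.+1; set C := cheb (m + d.+2).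
set D := cheb d; set E := cheb d.+1; set G := cheb _.+3; set H := cheb _.+2.
move=> E2 E1.
have -> : 'X * (2 * B + 2 - A - 'X * B) * C =
  2 * ('X * B * C) + 2 * ('X * C) - 'X * A * C - 'X * ('X * B * C) by ring.
by rewrite E2 E1; ring.
Qed.

Lemma cheb_mul m k :
  'X * cheb m * cheb k = 2 * (cheb m + cheb k) - (cheb `|m - k| + cheb (m + k)).
Proof.
case: (leqP m k) => [/subnKC <-|/ltnW/subnKC <-].
  rewrite cheb_mul_leq; congr (_ - (cheb _ + _)); lia.
have := cheb_mul_leq k (m - k); set d := (m - k)%N => E.
rewrite mulrAC E [in RHS](addrC (cheb _) (cheb k)).
by congr (_ - (cheb _ + cheb _)); lia.
Qed.

(** Since [cheb 0 = 0], the indices start at 1; the [n] polynomials used have sizes 1 to [n], a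
    triangular basis of the polynomials of size at most [n]. *)
Definition cheb_comb (n : nat) (c : nat -> F) : {poly F} :=
  \sum_(j < n) c j *: cheb j.+1.

Lemma size_cheb_comb n c : (size (cheb_comb n c) <= n)%N.
Proof.
apply: (leq_trans (size_sum _ _ _)); apply/bigmax_leqP => i _.
by rewrite (leq_trans (size_scale_leq _ _)) // size_cheb.
Qed.

Lemma size_cheb_combS n c : c n != 0 -> size (cheb_comb n.+1 c) = n.+1.
Proof.
move=> cn; rewrite /cheb_comb big_ord_recr /= addrC size_polyDl size_scale ?size_cheb //.
by rewrite ltnS size_cheb_comb.
Qed.

Lemma cheb_comb_exists n (g : {poly F}) :
  (size g <= n)%N -> exists c, g = cheb_comb n c.
Proof.
elim: n g => [|n IH] g.
  by rewrite leqn0 size_poly_eq0 => /eqP ->; exists (fun=> 0); rewrite /cheb_comb big_ord0.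
move=> sg; have lc : lead_coef (cheb n.+1) != 0.
  by rewrite lead_coef_eq0 -size_poly_eq0 size_cheb.
(* This multiple of [cheb n.+1] cancels the coefficient of degree [n]. *)
pose b := g`_n / lead_coef (cheb n.+1).
have [|c Ec] := IH (g - b *: cheb n.+1).
  apply/leq_sizeP => j; rewrite leq_eqVlt => /predU1P[<-|nj].
    rewrite coefB coefZ /b /lead_coef size_cheb divfK ?subrr //.
    by move: lc; rewrite /lead_coef size_cheb.
  by rewrite coefB coefZ !nth_default ?mulr0 ?subrr ?size_cheb // (leq_trans sg).
exists (fun j => if j == n then b else c j).
rewrite /cheb_comb big_ord_recr /= eqxx -[LHS](subrK (b *: cheb n.+1)) Ec.
by congr (_ + _); apply: eq_bigr => i _; rewrite ltn_eqF.
Qed.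

Lemma cheb_comb_inj n c d :
  cheb_comb n c = cheb_comb n d -> forall j, (j < n)%N -> c j = d j.
Proof.
elim: n c d => [//|n IH] c d E.
have cd : c n = d n.
  have lc : (cheb n.+1)`_n != 0.
    move: (size_cheb n.+1) => /(congr1 predn) /= {2}<-.
    by rewrite -/(lead_coef _) lead_coef_eq0 -size_poly_eq0 size_cheb.
  move/(congr1 (fun g : {poly F} => g`_n)): E.
  rewrite /cheb_comb !big_ord_recr /= -!/(cheb_comb _ _) !coefD !coefZ.
  by rewrite !(nth_default _ (size_cheb_comb _ _)) !add0r => /(mulIf lc).
move=> j; rewrite ltnS leq_eqVlt => /predU1P[->//|]; apply: IH.
by move: E; rewrite /cheb_comb !big_ord_recr /= cd => /addIr.
Qed.

End Cheb.

(** * Polynomial coordinates on J *)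

Section IdealsInJ.
Variables (F : fieldType) (V : lmodType F) (mul : V -> V -> V).
Variables (a : int -> V) (s : nat -> V) (p : 'Z_3 -> nat -> V).
Hypotheses (two_neq0 : (2%:R : F) != 0) (three_neq0 : (3%:R : F) != 0).
Hypothesis H : is_Hhat mul a s p.

Lemma four_neq0 : (4 : F) != 0.
Proof. by rewrite (natrM F 2 2) mulf_neq0. Qed.

Lemma eight_neq0 : (8 : F) != 0.
Proof. by rewrite (natrM F 2 4) mulf_neq0 ?four_neq0. Qed.

Lemma mulvDr c x y w : mul w (c *: x + y) = c *: mul w x + mul w y.
Proof. by rewrite (Hh_mulC H) (Hh_mulDl H) !(Hh_mulC H w). Qed.

Lemma mulv0 w : mul w 0 = 0.
Proof.
apply: (addIr (mul w 0)).
by rewrite -{1}[mul w 0]scale1r -mulvDr scale1r addr0 add0r.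
Qed.

Lemma mulvD x y w : mul w (x + y) = mul w x + mul w y.
Proof. by rewrite -[x in LHS]scale1r mulvDr scale1r. Qed.

Lemma mulvZ c x w : mul w (c *: x) = c *: mul w x.
Proof. by rewrite -[c *: x in LHS]addr0 mulvDr mulv0 addr0. Qed.

Lemma mulv_sum n (E : 'I_n -> V) w : mul w (\sum_(i < n) E i) = \sum_(i < n) mul w (E i).
Proof. exact: (big_morph _ (fun x y => mulvD x y w) (mulv0 w)). Qed.

Lemma in3N_mul3 k : in3N (3 * k.+1).
Proof. by rewrite /in3N dvdn_mulr. Qed.

Lemma p_zero r : p r 0 = 0.
Proof. exact: (Hh_pout H). Qed.

(* On J, [shift] acts as multiplication by X: see [embXM]. *)
Definition shift (x : V) : V := (8 / 3) *: mul (s 3) x.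

(* [emb r] is the linear map [X^i |-> shift^i p_{r,3}]; by [emb_cheb], J is [emb 1] + [emb 2] of the polynomial ring. *)
Definition emb (r : 'Z_3) (g : {poly F}) : V := \sum_(i < size g) g`_i *: iter i shift (p r 3).

Lemma embE n r (g : {poly F}) :
  (size g <= n)%N -> emb r g = \sum_(i < n) g`_i *: iter i shift (p r 3).
Proof.
move=> sg; rewrite /emb (big_ord_widen n (fun i => g`_i *: iter i shift (p r 3))) //.
rewrite big_mkcond /=; apply: eq_bigr => i _; case: ltnP => // si.
by rewrite nth_default // scale0r.
Qed.

Lemma emb_is_linear r : linear (emb r).
Proof.
move=> c g h; set n := maxn (size g) (size h).
rewrite !(@embE n) ?leq_maxl ?leq_maxr //; last first.
  apply: (leq_trans (size_polyD _ _)); rewrite geq_max leq_maxr andbT.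
  by apply: (leq_trans (size_scale_leq _ _)); rewrite leq_maxl.
rewrite scaler_sumr -big_split; apply: eq_bigr => i _ /=.
by rewrite coefD coefZ scalerDl scalerA.
Qed.

HB.instance Definition _ r := GRing.isLinear.Build F {poly F} V *:%R (emb r) (emb_is_linear r).

Lemma embXM r g : emb r ('X * g) = shift (emb r g).
Proof.
rewrite mulrC (@embE (size g).+1) ?size_polyMX_leq //; last first.
  by rewrite (leq_trans (size_polyMleq _ _)) // size_polyX addn2.
rewrite big_ord_recl coefMX scale0r add0r /emb /shift mulv_sum scaler_sumr.
by apply: eq_bigr => i _; rewrite coefMX /= mulvZ !scalerA mulrC.
Qed.

(** (H5) with j = 3, scaled by 8/3, has coefficients 2 and 1 and so becomes the recursion
    [chebSS]. *)
Lemma emb_cheb r k : emb r (cheb F k) = p r (3 * k).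
Proof.
suff [] : emb r (cheb F k) = p r (3 * k) /\ emb r (cheb F k.+1) = p r (3 * k.+1) by [].
elim: k => [|k [IH1 IH2]].
  split; first by rewrite raddf0 p_zero.
  by rewrite cheb1 (@embE 1) ?size_poly1 // big_ord1 coef1 scale1r.
split => //.
have Ep3 : emb r 1 = p r 3.
  by rewrite (@embE 1) ?size_poly1 // big_ord1 coef1 scale1r.
have -> : cheb F k.+2 = (cheb F k.+1 + 1) *+ 2 - cheb F k - 'X * cheb F k.+1.
  by rewrite chebSS; ring.
rewrite !raddfB raddfMn raddfD /= embXM IH1 IH2 Ep3.
rewrite /shift (Hh_H5 H) ?in3N_mul3 // scalerBr !scalerA.
have -> : 8 / 3 * (3 / 4) = 2 :> F by field; rewrite three_neq0 four_neq0.
have -> : 8 / 3 * (3 / 8) = 1 :> F by field; rewrite three_neq0 eight_neq0.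
rewrite scale1r (_ : `|3 - (3 * k.+1)%N|%N = 3 * k)%N; last by lia.
rewrite (_ : 3 + 3 * k.+1 = 3 * k.+2)%N; last by lia.
by rewrite scaler_nat [p r 3 + _]addrC opprB !addrA subrK addrAC subrr add0r.
Qed.

Lemma emb_cheb_comb r n c : emb r (cheb_comb n c) = \sum_(j < n) c j *: p r (3 * j.+1).
Proof.
by rewrite /cheb_comb linear_sum; apply: eq_bigr => j _; rewrite linearZ /= emb_cheb.
Qed.

Lemma emb0 g : emb 0 g = - emb 1 g - emb 2 g.
Proof.
have [c ->] := cheb_comb_exists (leqnn (size g)).
rewrite !emb_cheb_comb -!sumrN -big_split; apply: eq_bigr => j _ /=.
by rewrite (Hh_p0 H) scalerBr scalerN.
Qed.

(** In [cheb] coordinates the sum is a combination of the basis vectors p_{1,3j} and p_{2,3j}, so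
    freeness kills every coefficient. *)
Lemma emb12_eq0 g h : emb 1 g + emb 2 h = 0 -> g = 0 /\ h = 0.
Proof.
set n := maxn (size g) (size h).
have [|c ->] := @cheb_comb_exists _ n g; first exact: leq_maxl.
have [|d ->] := @cheb_comb_exists _ n h; first exact: leq_maxr.
rewrite !emb_cheb_comb => E.
pose l (t : bool) : seq hidx := [seq inr (inr (t, j)) | j <- iota 0 n].
pose e (b : hidx) := if b is inr (inr (t, m)) then if t then d m else c m else 0.
have ul : uniq (l false ++ l true).
  rewrite cat_uniq !map_inj_uniq ?iota_uniq ?andbT /=; last 2 first.
  - by move=> i j [].
  - by move=> i j [].
  by apply/hasPn => b /mapP[i _ ->]; apply/negP => /mapP[j _].
have cd0 := Hh_free H (c := e) ul.
have {}cd0 : forall t j, (j < n)%N -> e (inr (inr (t, j))) = 0.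
  move=> t j jn; apply: cd0; last first.
    by rewrite mem_cat; case: t; rewrite map_f ?orbT ?mem_iota.
  have E0 : iota 0 n = index_iota 0 n by rewrite /index_iota subn0.
  by rewrite /l big_cat !big_map /= E0 !big_mkord.
by split; rewrite /cheb_comb big1 // => j _;
  [rewrite [c j](cd0 false j) | rewrite [d j](cd0 true j)]; rewrite ?scale0r.
Qed.

Lemma emb12_inj g h g' h' :
  emb 1 g + emb 2 h = emb 1 g' + emb 2 h' -> g = g' /\ h = h'.
Proof.
move/eqP; rewrite -subr_eq0 opprD addrACA -!raddfB => /eqP /emb12_eq0 [/eqP].
by rewrite subr_eq0 => /eqP -> /eqP; rewrite subr_eq0 => /eqP ->.
Qed.

(** * Action of the basis elements on J *)

Lemma mul_emb_ext w r (M : {poly F} -> V) : linear M ->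
    (forall k, mul w (p r (3 * k.+1)) = M (cheb F k.+1)) ->
  forall g, mul w (emb r g) = M g.
Proof.
move=> linM HM g; have [c ->] := cheb_comb_exists (leqnn (size g)).
elim: (size g) => [|n IH].
  rewrite /cheb_comb big_ord0 raddf0 mulv0.
  by apply: (addIr (M 0)); rewrite add0r -{2}[M 0]scale1r -linM scale1r addr0.
rewrite /cheb_comb big_ord_recr /= -/(cheb_comb n c) addrC linM -IH.
by rewrite linearP /= mulvDr emb_cheb HM.
Qed.

Lemma mul_a_emb i r g :
  mul (a i) (emb r g) = (3 / 2) *: emb r g - emb (- (zbar i + r)) g.
Proof.
apply: (@mul_emb_ext (a i) r (fun g => (3 / 2) *: emb r g - emb (- (zbar i + r)) g)).
  by move=> c x y; rewrite !linearP /= addrACA !scalerA [c * _]mulrC.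
by move=> k; rewrite !emb_cheb (Hh_H3 H) ?in3N_mul3.
Qed.

(** The right-hand sides of (H5) and (H6) have this shape, with [c] equal to 3/8 and 1/8. *)
Lemma scale_cheb_mul (c : F) m k :
  (c * 2) *: (cheb F m + cheb F k) - c *: (cheb F `|m - k| + cheb F (m + k))
  = c *: ('X * cheb F m * cheb F k).
Proof. by rewrite cheb_mul scalerBr -scalerA scaler_nat mulr_natl. Qed.

Lemma mul_s3_emb m r g : (0 < m)%N ->
  mul (s (3 * m)) (emb r g) = (3 / 8) *: emb r ('X * cheb F m * g).
Proof.
move=> m0; apply: (@mul_emb_ext _ r (fun g => (3 / 8) *: emb r ('X * cheb F m * g))).
  by move=> c x y; rewrite mulrDr -scalerAr !linearP.
move=> k; rewrite (Hh_H5 H) ?in3N_mul3 ?muln_gt0 //.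
rewrite (_ : `|(3 * m)%N - (3 * k.+1)%N|%N = 3 * `|m - k.+1|)%N; last by lia.
rewrite -mulnDr -!emb_cheb -!raddfD -!linearZ -raddfB /= -scale_cheb_mul.
by congr (emb _ (_ *: _ - _)); field; rewrite four_neq0 eight_neq0.
Qed.

(** If 3 does not divide [j], then p_{r,j}, p_{r,|j-k|} and p_{r,j+k} all vanish, and (H5) leaves
    only a scalar. *)
Lemma mul_s_notin3N_emb j r g : ~~ in3N j -> (0 < j)%N ->
  mul (s j) (emb r g) = (3 / 4) *: emb r g.
Proof.
move=> j3 j0; apply: (@mul_emb_ext _ r (fun g => (3 / 4) *: emb r g)).
  by move=> c x y; rewrite !linearP.
move=> k; rewrite (Hh_H5 H) ?in3N_mul3 // emb_cheb.
rewrite [p r j](Hh_pout H) // [p r `| _ |%N](Hh_pout H) 1?[p r (_ + _)](Hh_pout H).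
- by rewrite add0r addr0 scaler0 subr0.
- by move: j3; rewrite /in3N; lia.
by move: j3; rewrite /in3N; lia.
Qed.

Lemma mul_p_emb t m r g :
  mul (p t (3 * m.+1)) (emb r g) =
  8^-1 *: (emb (- (t + r) + 1) ('X * cheb F m.+1 * g)
           - emb (- (t + r) - 1) ('X * cheb F m.+1 * g)).
Proof.
apply: (@mul_emb_ext _ r (fun g =>
  8^-1 *: (emb (- (t + r) + 1) ('X * cheb F m.+1 * g)
           - emb (- (t + r) - 1) ('X * cheb F m.+1 * g)))).
  move=> c x y; rewrite mulrDr -scalerAr !linearP /=.
  by rewrite addrACA -scalerDr [LHS]scalerDr !scalerA [c * _]mulrC.
move=> k; rewrite (Hh_H6 H) ?in3N_mul3 //; set u := - (t + r).
rewrite (_ : `|(3 * m.+1)%N - (3 * k.+1)%N|%N = 3 * `|m.+1 - k.+1|)%N; last by lia.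
rewrite -mulnDr /z -!emb_cheb scalerBr -!linearZ /= -!scale_cheb_mul.
rewrite !linearB !linearZ !linearD /=.
have -> : 8^-1 * 2 = 4^-1 :> F by field; rewrite four_neq0 eight_neq0.
rewrite !scalerDr !scalerN !opprK.
by rewrite [LHS](AC ((2*2)*(2*2)) (((1*3)*(5*7))*((2*4)*(6*8)))).
Qed.

(** * The ideal of J attached to a polynomial *)

Definition multiples (f : {poly F}) (v : V) : Prop :=
  exists g h, v = emb 1 (f * g) + emb 2 (f * h).

Lemma multiplesD f c x y :
  multiples f x -> multiples f y -> multiples f (c *: x + y).
Proof.
move=> [g [h ->]] [g' [h' ->]]; exists (c *: g + g'), (c *: h + h').
by rewrite !mulrDr -!scalerAr !linearP /= scalerDr addrACA.
Qed.

Lemma multiples0 f : multiples f 0.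
Proof. by exists 0, 0; rewrite !mulr0 !raddf0 addr0. Qed.

Lemma multiplesZ f c x : multiples f x -> multiples f (c *: x).
Proof. by move=> fx; rewrite -[c *: x]addr0; apply: multiplesD (multiples0 f). Qed.

Lemma multiplesB f x y : multiples f x -> multiples f y -> multiples f (x - y).
Proof. by move=> fx fy; rewrite addrC -scaleN1r; apply: multiplesD. Qed.

Lemma Z3_cases (r : 'Z_3) : [\/ r = 0, r = 1 | r = 2].
Proof.
case: r => [[|[|[|//]]] r3]; [constructor 1 | constructor 2 | constructor 3];
  exact: val_inj.
Qed.

Lemma multiples_emb f r g : multiples f (emb r (f * g)).
Proof.
have m1 : multiples f (emb 1 (f * g)) by exists g, 0; rewrite mulr0 raddf0 addr0.
have m2 : multiples f (emb 2 (f * g)) by exists 0, g; rewrite mulr0 raddf0 add0r.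
case: (Z3_cases r) => -> //; rewrite emb0 -scaleN1r.
by apply: multiplesB m2; apply: multiplesZ.
Qed.

(** Each basis element changes only the index [r] and multiplies the polynomial by a scalar or by
    some ['X * cheb m], so divisibility by [f] survives. *)
Lemma mul_basis_emb b f r g : multiples f (mul (hbasis a s p b) (emb r (f * g))).
Proof.
have me q t : multiples f (emb t (q * (f * g))).
  by rewrite mulrCA; apply: multiples_emb.
case: b => [i|[j|[t m]]] /=.
- by rewrite mul_a_emb; apply: multiplesB; first apply: multiplesZ; apply: multiples_emb.
- have [/dvdnP[m Em]|j3] := boolP (3 %| j.+1)%N.
    by rewrite Em mulnC mul_s3_emb; [exact: multiplesZ | lia].
  have {}j3 : ~~ in3N j.+1 by rewrite /in3N /=.
  by rewrite mul_s_notin3N_emb //; apply: multiplesZ; apply: multiples_emb.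
- by rewrite mul_p_emb; apply: multiplesZ; apply: multiplesB.
Qed.

Lemma multiples_ideal f : is_ideal mul (multiples f).
Proof.
split; first exact: multiples0.
split=> [c x y|x y]; first exact: multiplesD.
move=> [g [h ->]]; have [l [c ->]] := Hh_span H y.
elim: l => [|b l IH].
  by rewrite big_nil (Hh_mulC H) mulv0; apply: multiples0.
rewrite big_cons (Hh_mulDl H); apply: multiplesD => //.
rewrite mulvD -[mul _ (emb 1 _)]scale1r.
by apply: multiplesD; apply: mul_basis_emb.
Qed.

Lemma Jideal_multiples x : Jideal mul p x -> multiples 1 x.
Proof.
apply; first exact: multiples_ideal.
move=> _ [r [k [/andP[k0 /dvdnP[m Em]] [_ ->]]]].
by rewrite Em mulnC -emb_cheb -[cheb F m]mul1r; apply: multiples_emb.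
Qed.

(** * Splitting an ideal into polynomial components *)

Section Ideal.
Variable I : V -> Prop.
Hypothesis idI : is_ideal mul I.

Lemma ideal0 : I 0. Proof. by case: idI. Qed.

Lemma idealD c x y : I x -> I y -> I (c *: x + y).
Proof. by case: idI => _ [+ _]; apply. Qed.

Lemma idealM x y : I x -> I (mul y x).
Proof. by case: idI => _ [_]; apply. Qed.

Lemma idealZ c x : I x -> I (c *: x).
Proof. by move=> Ix; rewrite -[c *: x]addr0; apply: idealD ideal0. Qed.

Lemma idealB x y : I x -> I y -> I (x - y).
Proof. by move=> Ix Iy; rewrite addrC -scaleN1r; apply: idealD. Qed.

(* By (H3), [x |-> 3/2 x - a_i x] is the reflection [p_r |-> p_{-(i+r)}]. *)
Lemma ideal_reflect i g h : I (emb 1 g + emb 2 h) ->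
  I (emb (- (zbar i + 1)) g + emb (- (zbar i + 2)) h).
Proof.
move=> Ix; have := idealB (idealZ (3 / 2) Ix) (idealM (a i) Ix).
have subBK (u w : V) : u - (u - w) = w by rewrite opprB addrCA subrr addr0.
by rewrite mulvD !mul_a_emb scalerDr opprD addrACA !subBK.
Qed.

(** The reflection of a_0 exchanges p_1 and p_2. *)
Lemma ideal_swap g h : I (emb 1 g + emb 2 h) -> I (emb 1 h + emb 2 g).
Proof.
move/(ideal_reflect 0); rewrite [emb 1 h + _]addrC.
rewrite (_ : - (zbar 0 + 1) = 2); last exact: val_inj.
by rewrite (_ : - (zbar 0 + 2) = 1) //; apply: val_inj.
Qed.

Lemma ideal_split g h : I (emb 1 g + emb 2 h) -> I (emb 1 g) /\ I (emb 1 h).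
Proof.
(* The reflection of a_1 fixes p_1 and sends p_2 to p_0 = - p_1 - p_2; adding it to the identity
   cancels the p_2 component. *)
have fst u v : I (emb 1 u + emb 2 v) -> I (emb 1 (u *+ 2 - v)).
  move=> Ix; have := idealD 1 Ix (ideal_reflect 1 Ix).
  rewrite (_ : - (zbar 1 + 1) = 1); last exact: val_inj.
  rewrite (_ : - (zbar 1 + 2) = 0); last exact: val_inj.
  rewrite emb0 scale1r [emb 1 u + (_ - _)]addrA addrACA subrr addr0 addrA -mulr2n.
  by rewrite -raddfMn -raddfB.
(* Using the swapped element too, 2(2u - v) + (2v - u) = 3u, and 3 is invertible. *)
have fst3 u v : I (emb 1 u + emb 2 v) -> I (emb 1 u).
  move=> Ix; have := idealD 2 (fst _ _ Ix) (fst _ _ (ideal_swap Ix)).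
  rewrite -linearP /=.
  have -> : 2 *: (u *+ 2 - v) + (v *+ 2 - u) = 3 *: u.
    by rewrite -!mul_polyC !polyC_natr; ring.
  by move/(idealZ 3^-1); rewrite linearZ /= scalerA mulVf // scale1r.
by move=> Ix; split; [apply: fst3 Ix | apply: fst3 (ideal_swap Ix)].
Qed.

(** Multiplication by X is a scalar multiple of the action of s_3, under which an ideal is
    stable. *)
Lemma ideal_emb1M q g : I (emb 1 g) -> I (emb 1 (q * g)).
Proof.
move=> Ig; elim/poly_ind: q => [|q c IH]; first by rewrite mul0r raddf0; apply: ideal0.
rewrite mulrDl mul_polyC addrC (mulrC q) -mulrA linearP /=; apply: idealD => //.
by rewrite embXM; apply: idealZ; apply: idealM.
Qed.

Lemma ideal_emb2 g : I (emb 1 g) -> I (emb 2 g).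
Proof.
move=> Ig; rewrite -[emb 2 g]add0r -{1}(raddf0 (emb 1)).
by apply: ideal_swap; rewrite raddf0 addr0.
Qed.

Lemma multiples_sub f : I (emb 1 f) -> subset_of (multiples f) I.
Proof.
move=> If _ [g [h ->]]; rewrite -[emb 1 _]scale1r.
by apply: idealD; last apply: ideal_emb2; rewrite mulrC; apply: ideal_emb1M.
Qed.

End Ideal.

(** * Principality and divisibility *)

Lemma pideal_multiples f : same_set (pideal mul (emb 1 f)) (multiples f).
Proof.
move=> x; split=> [Px|fx I idI If].
  apply: Px; first exact: multiples_ideal.
  by move=> _ ->; rewrite -{2}[f]mulr1; apply: multiples_emb.
exact: (multiples_sub idI (If _ erefl)).
Qed.

Lemma multiplesP f g h : multiples f (emb 1 g + emb 2 h) <-> f %| g /\ f %| h.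
Proof.
split=> [[g' [h' /emb12_inj[-> ->]]]|]; first by rewrite !dvdp_mulr.
by move=> [/dvdpP[u ->] /dvdpP[v ->]]; exists u, v; rewrite !(mulrC f).
Qed.

Lemma multiples_emb1 f g : multiples f (emb 1 g) <-> f %| g.
Proof.
by rewrite -[emb 1 g]addr0 -(raddf0 (emb 2)) multiplesP dvdp0; split=> [[]|].
Qed.

(** Euclidean division by a non-zero element of least size; excluded middle supplies it, as [Y] is
    an arbitrary predicate. *)
Lemma poly_ideal_principal (Y : {poly F} -> Prop) :
    Y 0 -> (forall q g h, Y g -> Y h -> Y (h - q * g)) ->
  exists2 f, Y f & forall g, Y g -> f %| g.
Proof.
move=> Y0 YB; have [[g [Yg g0]]|Yz] := classic (exists g, Y g /\ g != 0); last first.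
  exists 0 => // g Yg; rewrite dvd0p; apply/negPn/negP => g0.
  by apply: Yz; exists g.
have [n] := ubnP (size g); elim: n g Yg g0 => // n IH g Yg g0 sg.
have [[h [Yh h0 hg]]|gmin] :=
    classic (exists h, [/\ Y h, h != 0 & (size h < size g)%N]).
  by apply: (IH h) => //; apply: leq_trans hg _.
exists g => // h Yh; apply/negPn/negP => gh; apply: gmin.
exists (h %% g); split=> //; last by rewrite ltn_modp.
by rewrite -[h %% g](addKr (h %/ g * g)) -divp_eq addrC; apply: YB.
Qed.

(** The polynomials [g] with [emb 1 g] in [I] form an ideal of F[X]; by [ideal_split] its generator
    divides both components of every element of [I]. *)
Lemma ideal_in_J I : is_ideal mul I -> subset_of I (Jideal mul p) ->
  exists2 f, I (emb 1 f) & same_set I (multiples f).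
Proof.
move=> idI IJ.
have [||f If fmin] := @poly_ideal_principal (fun g => I (emb 1 g)).
- by rewrite raddf0; apply: ideal0 idI.
- move=> q g h Ig Ih; rewrite raddfB; apply: idealB => //; exact: ideal_emb1M.
exists f => // x; split=> [Ix|]; last exact: multiples_sub.
have [g [h Ex]] := Jideal_multiples (IJ x Ix).
move: Ix; rewrite Ex !mul1r => /(ideal_split idI)[Ig Ih].
by apply/multiplesP; split; apply: fmin.
Qed.

(** * Tuples as polynomials *)

Definition tuple_poly (beta : seq F) : {poly F} := cheb_comb (size beta) (nth 0 beta).

Lemma peltE beta : pelt p beta = emb 1 (tuple_poly beta).
Proof. by rewrite emb_cheb_comb. Qed.

Lemma size_tuple_poly beta : valid_tuple beta -> size (tuple_poly beta) = size beta.
Proof.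
case: beta => // x beta /andP[_]; rewrite -nth_last => nz.
exact: size_cheb_combS nz.
Qed.

Lemma tuple_poly_neq0 beta : valid_tuple beta -> tuple_poly beta != 0.
Proof. by move=> vb; rewrite -size_poly_gt0 size_tuple_poly //; case/andP: vb. Qed.

Lemma cheb_comb_tuple n c : cheb_comb n c = tuple_poly (mkseq c n).
Proof.
rewrite /tuple_poly size_mkseq; apply: eq_bigr => j _.
by rewrite nth_mkseq.
Qed.

Lemma tuple_poly_exists f : f != 0 -> exists2 beta, valid_tuple beta & f = tuple_poly beta.
Proof.
move=> f0; have [c Ef] := cheb_comb_exists (leqnn (size f)).
exists (mkseq c (size f)); last by rewrite -cheb_comb_tuple.
rewrite /valid_tuple size_mkseq size_poly_gt0 f0 /= -nth_last size_mkseq.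
move: Ef; rewrite nth_mkseq ?prednK ?size_poly_gt0 //.
have : (0 < size f)%N by rewrite size_poly_gt0.
case sf: (size f) => [//|n] _ Ef.
(* With a zero last coordinate, [f] would be a combination of [n] terms and have size at most
   [n]. *)
apply/eqP => cn0; have := size_cheb_comb n c.
suff <- : f = cheb_comb n c by rewrite sf ltnn.
by rewrite Ef /cheb_comb big_ord_recr /= cn0 scale0r addr0.
Qed.

Lemma tuple_poly_scale c beta : tuple_poly (map ( *%R c) beta) = c *: tuple_poly beta.
Proof.
rewrite /tuple_poly size_map scaler_sumr; apply: eq_bigr => j _.
by rewrite (nth_map 0) // scalerA.
Qed.

(** Equal lengths matter: trailing zeros do not change the polynomial. *)
Lemma tuple_poly_inj beta beta' :
  size beta = size beta' -> tuple_poly beta = tuple_poly beta' -> beta = beta'.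
Proof.
move=> sb; rewrite /tuple_poly -sb => /cheb_comb_inj E.
exact: eq_from_nth sb E.
Qed.

Lemma pelt_multiples beta :
  same_set (pideal mul (pelt p beta)) (multiples (tuple_poly beta)).
Proof. by rewrite peltE; apply: pideal_multiples. Qed.

Lemma multiples_neq0 f : (exists x, multiples f x /\ x != 0) -> f != 0.
Proof.
move=> [x [[g [h ->]] x0]]; apply: contraNneq x0 => ->.
by rewrite !mul0r !raddf0 addr0.
Qed.

Lemma emb1_neq0 f : f != 0 -> emb 1 f != 0.
Proof.
apply: contraNneq => f0; have [|-> //] := @emb12_eq0 f 0.
by rewrite f0 raddf0 addr0.
Qed.

Lemma eqp_multiples f g : f %= g -> same_set (multiples f) (multiples g).
Proof.
have sub u v : v %| u -> subset_of (multiples u) (multiples v).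
  by move=> vu _ [w [h ->]]; apply/multiplesP; rewrite !dvdp_mulr.
by move=> /andP[fg gf] x; split; apply: sub.
Qed.

(** * Elements of minimal J-degree *)

Lemma Jdeg_tuple beta : valid_tuple beta ->
  Jdeg p (pelt p beta) ((3 * size beta)%:R + 4^-1).
Proof.
move=> vb; have /andP[sb nz] := vb.
case: beta sb nz {vb} => // b beta _; rewrite -nth_last /= => nz.
(* Here [beta] is the tail of the tuple, so its size is the top index and the p-level is
   [3 * (size beta).+1]. *)
exists (size beta), (nth 0 (b :: beta)), (fun=> 0); split.
  by apply: eq_bigr => j _; rewrite scale0r addr0.
by split; [left | rewrite nz eqxx /= mul0r addr0 mul1r].
Qed.

(* f divides both components of x, so the level of x is at least that of f, and
   a non-zero leading p_2-coefficient would exceed the J-degree of [emb 1 f]. *)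
Lemma min_Jdeg_multiples f x : f != 0 -> min_Jdeg p (multiples f) x ->
  exists beta, [/\ valid_tuple beta, x = pelt p beta & f %= tuple_poly beta].
Proof.
move=> f0 [fx [x0 [d [[m [c1 [c2 [Ex [nz Ed]]]]] dmin]]]].
have [beta vb Ef] := tuple_poly_exists f0.
have sf : size f = size beta by rewrite Ef size_tuple_poly.
(* Minimality is tested against [emb 1 f], giving [d] at most 3 times the size of [f] plus 1/4. *)
have := dmin (pelt p beta) _ _ _ (Jdeg_tuple vb).
rewrite peltE -Ef multiples_emb1 dvdpp emb1_neq0 // => /(_ isT isT) {dmin}.
have {}Ex : x = emb 1 (cheb_comb m.+1 c1) + emb 2 (cheb_comb m.+1 c2).
  by rewrite Ex big_split !emb_cheb_comb.
move: fx; rewrite Ex => /multiplesP[f1 f2] dle.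
have fm : (size beta <= m.+1)%N.
  rewrite -sf; case: nz => /[dup] cn /size_cheb_combS sc; rewrite -sc;
    by apply: dvdp_leq => //; rewrite -size_poly_eq0 sc.
have c2m : c2 m = 0.
  apply/eqP/negPn/negP => c2n; move: dle; rewrite Ed c2n /=.
  have : ((3 * size beta)%:R <= (3 * m.+1)%:R :> rat) by rewrite ler_nat leq_mul2l.
  by case: (c1 m != 0) => /=; lra.
have c1m : c1 m != 0 by case: nz => //; rewrite c2m eqxx.
(* A strictly larger level would raise [d] by at least 3. *)
have {fm} Em : size beta = m.+1.
  apply/eqP; rewrite eqn_leq fm leqNgt; apply/negP => lt_m; move: dle.
  have : ((3 * (size beta).+1)%:R <= (3 * m.+1)%:R :> rat) by rewrite ler_nat leq_mul2l.
  rewrite Ed c1m c2m eqxx mulnS natrD /=; lra.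
have s1 := size_cheb_combS c1m.
exists (mkseq c1 m.+1); split.
- by rewrite /valid_tuple -nth_last size_mkseq nth_mkseq.
(* As [c2 m = 0], the second component has smaller size than [f]; being a multiple of [f], it is
   zero. *)
- rewrite peltE -cheb_comb_tuple; suff -> : cheb_comb m.+1 c2 = 0 by rewrite raddf0 addr0.
  apply: contraTeq f2 => c0; apply: contraL (ltnSn m) => /(dvdp_leq c0).
  rewrite sf Em -leqNgt => /leq_trans; apply.
  by rewrite /cheb_comb big_ord_recr /= c2m scale0r addr0 size_cheb_comb.
- by rewrite -cheb_comb_tuple -dvdp_size_eqp // s1 sf Em.
Qed.

End IdealsInJ.

(** * The bijection between tuples up to scalars and ideals *)

Theorem theorem1p8 (F : fieldType) (V : lmodType F) (mul : V -> V -> V)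
    (a : int -> V) (s : nat -> V) (p : 'Z_3 -> nat -> V) :
  (2%:R : F) != 0 -> (3%:R : F) != 0 ->
  is_Hhat mul a s p ->
  (* the map lands in the non-zero ideals contained in J *)
  (forall beta, valid_tuple beta ->
     is_ideal mul (pideal mul (pelt p beta)) /\
     (exists x, pideal mul (pelt p beta) x /\ x != 0) /\
     subset_of (pideal mul (pelt p beta)) (Jideal mul p)) /\
  (* it is constant on classes up to non-zero scalars *)
  (forall beta (c : F), valid_tuple beta -> c != 0 ->
     same_set (pideal mul (pelt p (map ( *%R c) beta))) (pideal mul (pelt p beta))) /\
  (* injective on classes *)
  (forall beta beta', valid_tuple beta -> valid_tuple beta' ->
     same_set (pideal mul (pelt p beta)) (pideal mul (pelt p beta')) ->
     exists c : F, c != 0 /\ beta' = map ( *%R c) beta) /\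
  (* surjective onto non-zero ideals contained in J *)
  (forall I : V -> Prop, is_ideal mul I -> (exists x, I x /\ x != 0) ->
     subset_of I (Jideal mul p) ->
     exists beta, valid_tuple beta /\ same_set I (pideal mul (pelt p beta))) /\
  (* the inverse: coefficients of an element of minimal J-degree *)
  (forall I : V -> Prop, is_ideal mul I -> (exists x, I x /\ x != 0) ->
     subset_of I (Jideal mul p) ->
     forall x, min_Jdeg p I x ->
     exists beta, valid_tuple beta /\ x = pelt p beta /\
                  same_set I (pideal mul (pelt p beta))) /\
  (* every ideal contained in J is principal *)
  (forall I : V -> Prop, is_ideal mul I -> subset_of I (Jideal mul p) ->
     exists x, same_set I (pideal mul x)).
Proof.
move=> two0 three0 H.
have pm := pelt_multiples two0 three0 H.
have rep I : is_ideal mul I -> (exists x, I x /\ x != 0) -> subset_of I (Jideal mul p) ->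
    exists f, f != 0 /\ same_set I (multiples mul s p f).
  move=> idI [x [Ix x0]] IJ; have [f _ If] := ideal_in_J two0 three0 H idI IJ.
  by exists f; split=> //; apply: multiples_neq0; exists x; split=> //; apply/If.
have same f g : f %= g -> same_set (multiples mul s p f) (multiples mul s p g).
  exact: (eqp_multiples two0 three0 H).
split; [|split; [|split; [|split; [|split]]]].
- move=> beta vb; split; [|split].
  + split; first by move=> I idI _; apply: ideal0 idI.
    split=> [c x y Px Py I idI HI|x y Px I idI HI].
      by apply: (idealD idI); [apply: Px | apply: Py].
    by apply: (idealM idI); apply: Px.
  + exists (pelt p beta); split; first by move=> I _; apply.
    by rewrite (peltE two0 three0 H) (emb1_neq0 two0 three0 H) ?tuple_poly_neq0.
  (* J is the intersection of the ideals containing all generators, and each of these contains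
     [pelt p beta]. *)
  + move=> x Px I idI genI; apply: Px => // _ ->.
    rewrite /pelt; apply: big_ind => [|u v Iu Iv|j _]; first exact: ideal0 idI.
      by rewrite -[u]scale1r; apply: (idealD idI).
    apply: (idealZ idI); apply: genI; exists 1, (3 * j.+1)%N.
    by rewrite in3N_mul3; split=> //; split=> //; left.
- move=> beta c vb c0 x; rewrite !pm tuple_poly_scale; apply: same.
  by rewrite eqp_scale.
- move=> beta beta' vb vb' E.
  (* The generator of the first ideal lies in the second, which means divisibility of polynomials;
     both directions make them associates. *)
  have fg u v : same_set (pideal mul (pelt p u)) (pideal mul (pelt p v)) ->
      tuple_poly v %| tuple_poly u.
    move=> Euv; apply/(multiples_emb1 two0 three0 H)/pm/Euv/pm.
    by apply/(multiples_emb1 two0 three0 H).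
  have : tuple_poly beta %= tuple_poly beta'.
    by rewrite /eqp !fg // => x; rewrite E.
  rewrite eqp_sym => /eqpf_eq[c c0 Ec]; exists c; split=> //.
  apply: tuple_poly_inj; last by rewrite tuple_poly_scale.
  by rewrite size_map -(size_tuple_poly vb) -(size_tuple_poly vb') Ec size_scale.
- move=> I idI In0 IJ; have [f [f0 If]] := rep I idI In0 IJ.
  have [beta vb Ef] := tuple_poly_exists f0.
  by exists beta; split=> // x; rewrite pm -Ef.
- move=> I idI In0 IJ x [Ix [x0 [d [dx dmin]]]].
  have [f [f0 If]] := rep I idI In0 IJ.
  (* Minimality is carried from [I] to the equal set [multiples f]. *)
  have [|beta [vb Ex fb]] := min_Jdeg_multiples two0 three0 H f0 (x := x).
    split; [exact/If | split=> //; exists d; split=> // y e /If; exact: dmin].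
  by exists beta; split=> //; split=> // y; rewrite pm If; apply: same.
- move=> I idI IJ; have [f _ If] := ideal_in_J two0 three0 H idI IJ.
  exists (emb mul s p 1 f) => x; rewrite If.
  by split=> /(pideal_multiples two0 three0 H).
Qed.
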